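(* Let $n$ be an odd positive integer and let $b_1,\dots,b_n$ be positive integers. The Dubrovnik polynomials $\mathcal{P}[b_1,\dots,b_n]$ of the standard braid-form diagrams $D[b_1,\dots,b_n]$ satisfy the following relations (each relation being asserted for all odd $n$ for which the entries explicitly displayed in it exist, i.e. $n\ge 3$ for relations 1--6 and $n\ge 5$ for relations 7--8): \begin{enumerate} \item $\mathcal{P}[b_1,b_2,\ldots,b_n]=\mathcal{P}[b_1-2,b_2,\ldots,b_n]-za^{1-b_1}\mathcal{P}[1,b_2-1,b_3,\ldots,b_n]+z\mathcal{P}[b_1-1,b_2,\ldots,b_n]$ for $b_1\ge 3$, $b_2\ge 2$. \item $\mathcal{P}[2,b_2,\ldots,b_n]=a^{b_2}\mathcal{P}[b_3,\ldots,b_n]-za^{-1}\mathcal{P}[1,b_2-1,b_3,\ldots,b_n]+z\mathcal{P}[1,b_2,\ldots,b_n]$ for $b_2\ge 2$. \item $\mathcal{P}[1,b_2,\ldots,b_n]=\mathcal{P}[1,b_2-2,b_3,\ldots,b_n]-z\mathcal{P}[1,b_2-1,b_3,\ldots,b_n]+za^{b_2}\mathcal{P}[b_3,\ldots,b_n]$ for $b_2\ge 3$. \item $\mathcal{P}[b_1,1,b_3,\ldots,b_n]=\mathcal{P}[b_1-2,1,b_3,\ldots,b_n]-za^{1-b_1}\mathcal{P}[b_3+1,b_4,\ldots,b_n]+z\mathcal{P}[b_1-1,1,b_3,\ldots,b_n]$ for $b_1\ge 3$. \item $\mathcal{P}[2,1,b_3,\ldots,b_n]=a\mathcal{P}[b_3,\ldots,b_n]-za^{-1}\mathcal{P}[b_3+1,b_4,\ldots,b_n]+z\mathcal{P}[1,1,b_3,\ldots,b_n]$.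 \item $\mathcal{P}[1,2,b_3,\ldots,b_n]=\mathcal{P}[b_3+1,b_4,\ldots,b_n]-z\mathcal{P}[1,1,b_3,\ldots,b_n]+za^2\mathcal{P}[b_3,\ldots,b_n]$. \item $\mathcal{P}[1,1,b_3,b_4,\ldots,b_n]=a^{-b_3}\mathcal{P}[1,b_4-1,b_5,\ldots,b_n]-z\mathcal{P}[b_3+1,b_4,\ldots,b_n]+za\mathcal{P}[b_3,b_4,\ldots,b_n]$ for $b_4\ge 2$. \item $\mathcal{P}[1,1,b_3,1,b_5,\ldots,b_n]=a^{-b_3}\mathcal{P}[1+b_5,b_6,\ldots,b_n]-z\mathcal{P}[b_3+1,1,b_5,\ldots,b_n]+za\mathcal{P}[b_3,1,b_5,\ldots,b_n]$. \end{enumerate}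
   Context: All links are unoriented and given by planar diagrams. Inside a disk with four boundary points NW, NE, SW, SE consider four tangles: the crossing $X$, in which the strand joining NW to SE passes over the strand joining SW to NE; the switched crossing $\overline{X}$, in which the strand joining SW to NE passes over the strand joining NW to SE; the tangle $[0]$, consisting of two crossingless arcs NW--NE and SW--SE; and the tangle $[\infty]$, consisting of two crossingless arcs NW--SW and NE--SE. Dubrovnik polynomial: $P(K)=P(K)(z,a)\in\mathbb{Z}[a^{\pm1},z^{\pm1}]$ is the unique function of unoriented link diagrams $K$ such that (1) $P$ is invariant under regular isotopy (planar isotopy and Reidemeister moves II and III); (2) $P(K_X)-P(K_{\overline{X}})=z\,[P(K_{[0]})-P(K_{[\infty]})]$ whenever the four diagrams are identical outside a disk in which they are the indicated tangles; (3) removing a kink (Reidemeister I curl) whose crossing is positive multiplies out a factor $a$, i.e. $P(\text{diagram with positive curl})=a\,P(\text{diagram with the curl removed})$, and $P(\text{diagram with negative curl})=a^{-1}P(\text{diagram with the curl removed})$ (the sign of a self-crossing of a component does not depend on the orientation); (4) $P$ of the crossingless diagram of the unknot is $1$. Standard braid-form diagram $D[b_1,\dots,b_n]$ with all $b_i>0$: take four horizontal strands, at positions numbered $1,2,3,4$ from top to bottom, and close the left ends by joining position 1 to 2 and position 3 to 4. Going from left to right there are $n$ sections of twists. For $i$ odd, the $i$-th section is a horizontal row of $b_i$ crossings, each equal to $X$, between the strands in positions 2 and 3. For $i$ even, the $i$-th section is a horizontal row of $b_i$ crossings, each equal to $\overline{X}$, between the strands in positions 1 and 2. Finally close the right ends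 without crossings: if $n$ is odd join position 1 to 2 and 3 to 4; if $n$ is even join position 2 to 3 and position 1 to 4. These diagrams are alternating. Write $\mathcal{P}[b_1,\dots,b_n]:=P(D[b_1,\dots,b_n])$. *)

(* Defs.v *)
From Stdlib Require Import Relation_Operators.
From mathcomp Require Import all_boot all_order all_algebra.

Set Implicit Arguments.
Unset Strict Implicit.
Unset Printing Implicit Defensive.

Import GRing.Theory.
Local Open Scope ring_scope.

(** Laurent polynomials: Z[a^{±1}, z^{±1}] is taken inside its fraction field
    Frac(Z[z][a]), as the set of p / (a^i z^j) with p a polynomial. *)

Definition ratfun : fieldType := {fraction {poly {poly int}}}.
Definition poly_ratfun (p : {poly {poly int}}) : ratfun := @tofrac _ p.
Definition va : ratfun := poly_ratfun 'X.
Definition vz : ratfun := poly_ratfun ('X)%:P.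

Definition is_laurent (x : ratfun) : Prop :=
  exists (p : {poly {poly int}}) (i j : nat),
    x = poly_ratfun p / (va ^+ i * vz ^+ j).

Local Close Scope ring_scope.

(** Plane link diagrams.

    A plane diagram in general position with respect to the horizontal
    coordinate is cut by vertical lines into slices, each containing a single
    elementary piece besides horizontal strands.  It is recorded as the word of
    its slices, read from left to right.  A slice [(p, i)] has exactly [i]
    horizontal strands above the piece [p]; strands are thus numbered from 0,
    top to bottom.

    - [Cup] is an arc with a leftmost point: it opens two new strands;
    - [Cap] is an arc with a rightmost point: it joins two adjacent strands;
    - [Cross true] is the crossing X, whose NW--SE strand passes over;
    - [Cross false] is the switched crossing, whose SW--NE strand passes over. *)

Inductive piece := Cup | Cap | Cross of bool.

Notation crX := (Cross true).
Notation crXbar := (Cross false).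

Definition arity_in (p : piece) : nat := if p is Cup then 0 else 2.
Definition arity_out (p : piece) : nat := if p is Cap then 0 else 2.

Definition slice : Type := piece * nat.
Definition word : Type := seq slice.

(* [w] can be drawn to the right of [m] strands, and no strand is left at the
   end. *)
Fixpoint closes (m : nat) (w : word) : bool :=
  if w is (p, i) :: w' then
    (i + arity_in p <= m) && closes (m - arity_in p + arity_out p) w'
  else m == 0.

(* The empty diagram is excluded: the Dubrovnik polynomial is not determined
   on it by its defining properties. *)
Record diagram := Diagram {
  slices :> word;
  slicesP : closes 0 slices && ~~ nilp slices }.

(* Two diagrams identical outside a disk in which they are [l] and [r]. *)
Definition differ_by (l r : word) (K K' : diagram) : Prop :=
  exists u v : word, slices K = u ++ l ++ v /\ slices K' = u ++ r ++ v.

(** Planar isotopy.  Generic planar isotopies change the word of slices only by: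
    exchanging the order of two pieces, the first of which lies above the
    other with [k] strands in between; creating or cancelling a pair made of a
    leftmost and a rightmost point of an arc; and moving the leftmost or
    rightmost point of one strand of a crossing across that crossing, which
    rotates the crossing by a quarter turn and so exchanges X and its switched
    version. *)
Inductive planar_move : word -> word -> Prop :=
| Exchange p q i k : planar_move
    [:: (p, i); (q, i + arity_out p + k)] [:: (q, i + arity_in p + k); (p, i)]
| StraightenS i : planar_move [:: (Cup, i); (Cap, i.+1)] [::]
| StraightenZ i : planar_move [:: (Cup, i.+1); (Cap, i)] [::]
| RotateCup s i : planar_move
    [:: (Cup, i); (Cross s, i.+1)] [:: (Cup, i.+1); (Cross (~~ s), i)]
| RotateCap s i : planar_move
    [:: (Cross s, i.+1); (Cap, i)] [:: (Cross (~~ s), i); (Cap, i.+1)].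

(* In [R3] the three bits tell, for each pair of strands entering at i, i+1,
   i+2, whether the upper one passes over; the side condition says that "passes
   over" is not cyclic, i.e. that the strands lie at three distinct heights. *)
Inductive reidemeister23 : word -> word -> Prop :=
| R2 s i : reidemeister23 [:: (Cross s, i); (Cross (~~ s), i)] [::]
| R3 s t u i : (s == t) || (t == u) -> reidemeister23
    [:: (Cross s, i); (Cross t, i.+1); (Cross u, i)]
    [:: (Cross u, i.+1); (Cross t, i); (Cross s, i.+1)].

Definition isotopy_step (K K' : diagram) : Prop :=
  exists l r : word,
    (planar_move l r \/ reidemeister23 l r) /\ differ_by l r K K'.

Definition regular_isotopy : diagram -> diagram -> Prop :=
  clos_refl_sym_trans diagram isotopy_step.

(* [curl positive l r]: [l] is [r] with a curl added, whose crossing has the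
   given sign (right-handed crossings are positive).  In a curl around X, the
   crossing is positive when the loop joins two ends on the same horizontal
   side (NW--NE or SW--SE), negative when it joins NW--SW or NE--SE; around
   the switched crossing the signs are opposite. *)
Inductive curl : bool -> word -> word -> Prop :=
| CurlLeft s i : curl (~~ s) [:: (Cup, i); (Cross s, i)] [:: (Cup, i)]
| CurlRight s i : curl (~~ s) [:: (Cross s, i); (Cap, i)] [:: (Cap, i)]
| CurlTop s i : curl s [:: (Cup, i); (Cross s, i.+1); (Cap, i)] [::]
| CurlBottom s i : curl s [:: (Cup, i.+1); (Cross s, i); (Cap, i.+1)] [::].

Definition unknot : diagram :=
  @Diagram [:: (Cup, 0); (Cap, 0)] (erefl true).

Local Open Scope ring_scope.

(* [P] is the Dubrovnik polynomial. *)
Record dubrovnik (P : diagram -> ratfun) : Prop := {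
  dub_laurent : forall K, is_laurent (P K);
  dub_isotopy : forall K K', regular_isotopy K K' -> P K = P K';
  dub_skein : forall (u v : word) (i : nat) (KX KXbar K0 Koo : diagram),
    slices KX = u ++ [:: (crX, i)] ++ v ->
    slices KXbar = u ++ [:: (crXbar, i)] ++ v ->
    slices K0 = u ++ v ->
    slices Koo = u ++ [:: (Cap, i); (Cup, i)] ++ v ->
    P KX - P KXbar = vz * (P K0 - P Koo);
  dub_curl : forall (positive : bool) (l r : word) (K K' : diagram),
    curl positive l r -> differ_by l r K K' ->
    P K = (if positive then va else va^-1) * P K';
  dub_unknot : P unknot = 1 }.

Local Close Scope ring_scope.

(** Standard braid-form diagrams. *)

Fixpoint twists (odd_section : bool) (b : seq nat) : word :=
  if b is c :: b' then
    nseq c (if odd_section then (crX, 1) else (crXbar, 0)) ++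
    twists (~~ odd_section) b'
  else [::].

Definition right_closure (n : nat) : word :=
  if odd n then [:: (Cap, 2); (Cap, 0)] else [:: (Cap, 1); (Cap, 0)].

Definition standard_word (b : seq nat) : word :=
  [:: (Cup, 0); (Cup, 2)] ++ twists true b ++ right_closure (size b).

Lemma closes_twists o b w : closes 4 (twists o b ++ w) = closes 4 w.
Proof.
elim: b o => //= c b IHb o; rewrite -catA.
by elim: c => /= [|c IHc]; [exact: IHb | case: o IHc].
Qed.

Lemma standard_wordP b :
  closes 0 (standard_word b) && ~~ nilp (standard_word b).
Proof. by rewrite andbT /= closes_twists /right_closure; case: odd. Qed.

Definition D (b : seq nat) : diagram := Diagram (standard_wordP b).

(* Main.v *)
(** Apply the skein relation at the leftmost crossing of the first section.  The
    switched crossing cancels against its right neighbour.  In one smoothing the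
    crossing disappears; in the other, the rest of the section becomes a row of
    curls on an inner arc, and rotating the first crossing of the second section
    about that arc brings the diagram back to standard form (relations 1, 2, 4
    and 5).  When the first section is a single crossing, the second section is
    treated likewise (relations 3 and 6).  When both are single crossings,
    switching the second one yields X_1 X_0 X_1^c, which Reidemeister III moves
    turn into X_0^c X_1 X_0, where X_0^c is a row of curls on the upper arc
    (relations 7 and 8). *)

Require Import Defs.
From mathcomp Require Import all_boot all_order all_algebra.

Set Implicit Arguments.
Unset Strict Implicit.

Import GRing.Theory.
Local Open Scope ring_scope.

(** * Words of slices and the extension of [P] to them *)

Definition admissible (w : word) : bool := closes 0 w && ~~ nilp w.

Lemma closes_nseq_cross m c s i w : (i + 2 <= m)%N ->
  closes m (nseq c (Cross s, i) ++ w) = closes m w.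
Proof.
move=> le_im.
have le_2m : (2 <= m)%N by apply: leq_trans le_im; rewrite leq_addl.
by elim: c => //= c IHc; rewrite le_im subnK.
Qed.

Lemma right_closureSS n : right_closure n.+2 = right_closure n.
Proof. by rewrite /right_closure /= negbK. Qed.

(* The junk value 0 is taken on the words that are not diagrams. *)
Definition word_value (P : diagram -> ratfun) (w : word) : ratfun :=
  if @idP (admissible w) is ReflectT w_ok then P (Diagram w_ok) else 0.

(** The choice of admissibility proof is immaterial, since proofs of a boolean equality are
    unique. *)
Lemma word_valueE P w (w_ok : admissible w) : word_value P w = P (Diagram w_ok).
Proof.
rewrite /word_value; case: {-}_ / idP => [w_ok'|//].
by congr (P (Diagram _)); apply: bool_irrelevance.
Qed.

Section LeftEnd.

Variables (P : diagram -> ratfun) (P_dubrovnik : dubrovnik P).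

Local Notation ev := (word_value P).

(** * The axioms of the Dubrovnik polynomial, transferred to words *)

Definition curl_factor (positive : bool) : ratfun :=
  if positive then va else va^-1.

Lemma word_value_move u v l r :
    planar_move l r \/ reidemeister23 l r ->
    admissible (u ++ l ++ v) -> admissible (u ++ r ++ v) ->
  ev (u ++ l ++ v) = ev (u ++ r ++ v).
Proof.
move=> lr l_ok r_ok; rewrite !word_valueE.
apply: dub_isotopy => //; apply: Relation_Operators.rst_step.
by exists l, r; split=> //; exists u, v.
Qed.

Lemma word_value_curl u v l r positive : curl positive l r ->
    admissible (u ++ l ++ v) -> admissible (u ++ r ++ v) ->
  ev (u ++ l ++ v) = curl_factor positive * ev (u ++ r ++ v).
Proof.
move=> lr l_ok r_ok; rewrite !word_valueE.
by apply: (dub_curl P_dubrovnik lr); exists u, v.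
Qed.

Lemma word_value_skein u v i :
    admissible (u ++ (crX, i) :: v) -> admissible (u ++ (crXbar, i) :: v) ->
    admissible (u ++ v) -> admissible (u ++ [:: (Cap, i), (Cup, i) & v]) ->
  ev (u ++ (crX, i) :: v) - ev (u ++ (crXbar, i) :: v) =
    vz * (ev (u ++ v) - ev (u ++ [:: (Cap, i), (Cup, i) & v])).
Proof.
by move=> X_ok Xbar_ok ok0 oo_ok; rewrite !word_valueE; apply: dub_skein.
Qed.

Lemma cancel_crossings u v s i :
    admissible (u ++ v) ->
    admissible (u ++ [:: (Cross s, i), (Cross (~~ s), i) & v]) ->
  ev (u ++ [:: (Cross s, i), (Cross (~~ s), i) & v]) = ev (u ++ v).
Proof.
move=> v_ok w_ok.
by apply: (@word_value_move u v _ _ (or_intror (R2 s i)) w_ok v_ok).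
Qed.

(** * Isotopies and curls next to the two left cups *)

Lemma two_cups v : closes 4 v ->
  ev [:: (Cup, 0%N), (Cup, 0%N) & v] = ev [:: (Cup, 0%N), (Cup, 2%N) & v].
Proof.
move=> v_ok; apply/esym.
by apply: (@word_value_move [::] v _ _ (or_introl (Exchange Cup Cup 0 0)));
  rewrite /admissible /= ?v_ok.
Qed.

(** All crossings of the row lie on the two ends of the arc just opened, so they are left curls,
    removed one at a time. *)
Lemma cup_curls i s c v : (i <= 2)%N -> closes 4 v ->
  ev [:: (Cup, 0%N), (Cup, i) & nseq c (Cross s, i) ++ v] =
    curl_factor (~~ s) ^+ c * ev [:: (Cup, 0%N), (Cup, i) & v].
Proof.
move=> le_i2 v_ok; have le_i4 : (i + 2 <= 4)%N by rewrite (leq_add2r 2 i 2).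
elim: c => [|c IHc]; first by rewrite expr0 mul1r.
rewrite exprS -mulrA -IHc.
apply: (@word_value_curl [:: (Cup, 0%N)] _ _ _ _ (CurlLeft s i));
  by rewrite /admissible /= ?addn0 ?le_i2 ?le_i4 ?closes_nseq_cross ?v_ok.
Qed.

(** Opening the lower arc first puts the upper cup right before its row of curls. *)
Lemma cup_curls0 s c v : closes 4 v ->
  ev [:: (Cup, 0%N), (Cup, 2%N) & nseq c (Cross s, 0%N) ++ v] =
    curl_factor (~~ s) ^+ c * ev [:: (Cup, 0%N), (Cup, 2%N) & v].
Proof. by move=> v_ok; rewrite -!two_cups ?cup_curls ?closes_nseq_cross. Qed.

(** The inner arc turns about the crossing and comes out above the outer arc. This returns the
    [[oo]] smoothing to standard form, with a first section of length one. *)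
Lemma nested_cups_rotate v : closes 4 v ->
  ev [:: (Cup, 0%N), (Cup, 1%N), (crXbar, 0%N) & v] =
    ev [:: (Cup, 0%N), (Cup, 2%N), (crX, 1%N) & v].
Proof.
move=> v_ok; rewrite -two_cups //=; apply/esym.
by apply: (@word_value_move [:: (Cup, 0%N)] v _ _
  (or_introl (RotateCup true 0))); rewrite /admissible /= ?v_ok.
Qed.

Lemma two_cups_cap v : closes 2 v ->
  ev [:: (Cup, 0%N), (Cup, 2%N), (Cap, 1%N) & v] = ev ((Cup, 0%N) :: v).
Proof.
move=> v_ok; rewrite -two_cups //=.
by apply: (@word_value_move [:: (Cup, 0%N)] v _ _ (or_introl (StraightenS 0)));
  rewrite /admissible /= ?v_ok.
Qed.

(** Moving the cap across [crX] leaves a positive curl [crXbar] on the upper arc, followed by a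
    zigzag that straightens. *)
Lemma two_cups_cross_cap v : closes 2 v ->
  ev [:: (Cup, 0%N), (Cup, 2%N), (crX, 1%N), (Cap, 0%N) & v] =
    va * ev ((Cup, 0%N) :: v).
Proof.
(* The factor [va] is read as a row of one curl, so that [cup_curls0] applies backwards. *)
move=> v_ok; rewrite -(@two_cups_cap v) // -[va]/(curl_factor (~~ false) ^+ 1).
rewrite -cup_curls0 //=.
by apply: (@word_value_move [:: (Cup, 0%N); (Cup, 2%N)] v _ _
  (or_introl (RotateCap true 0))); rewrite /admissible /= ?v_ok.
Qed.

(** Each [R3] move trades one [crX] of the row for a [crX] on the upper arc, which is a negative
    curl. *)
Lemma cup_slide c v : closes 4 v ->
  ev [:: (Cup, 0%N), (Cup, 2%N), (crX, 1%N), (crX, 0%N) &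
      nseq c (crX, 1%N) ++ v] =
    va ^- c * ev [:: (Cup, 0%N), (Cup, 2%N), (crX, 1%N), (crX, 0%N) & v].
Proof.
move=> v_ok; elim: c => [|c IHc]; first by rewrite expr0 invr1 mul1r.
have w_ok : closes 4 (nseq c (crX, 1%N) ++ v) by rewrite closes_nseq_cross.
rewrite exprS invfM -mulrA -{}IHc -[va^-1]/(curl_factor (~~ true) ^+ 1).
rewrite -cup_curls0 //=; apply/esym.
by apply: (@word_value_move [:: (Cup, 0%N); (Cup, 2%N)] _ _ _
  (or_intror (@R3 true true true 0 isT))); rewrite /admissible /= ?w_ok.
Qed.

Lemma resolve_first_section v : closes 4 v ->
  ev [:: (Cup, 0%N), (Cup, 2%N), (crX, 1%N) & v] =
    ev [:: (Cup, 0%N), (Cup, 2%N), (crXbar, 1%N) & v]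
    - vz * ev [:: (Cup, 0%N), (Cup, 1%N) & v]
    + vz * ev [:: (Cup, 0%N), (Cup, 2%N) & v].
Proof.
(* The cap of the [[oo]] smoothing joins the two left arcs into one, inside which its cup then
   opens. *)
move=> v_ok; rewrite -(@two_cups_cap ((Cup, 1%N) :: v)) //=.
rewrite -addrA [X in _ = _ + X]addrC -mulrBr.
rewrite -(@word_value_skein [:: (Cup, 0%N); (Cup, 2%N)] v 1);
  by rewrite ?subrKC // /admissible /= ?v_ok.
Qed.

Lemma resolve_second_section v : closes 4 v ->
  ev [:: (Cup, 0%N), (Cup, 2%N), (crX, 1%N), (crXbar, 0%N) & v] =
    ev [:: (Cup, 0%N), (Cup, 2%N), (crX, 1%N), (crX, 0%N) & v]
    - vz * ev [:: (Cup, 0%N), (Cup, 2%N), (crX, 1%N) & v]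
    + vz * va * ev [:: (Cup, 0%N), (Cup, 0%N) & v].
Proof.
(* Here the cap of the [[oo]] smoothing closes up the preceding [crX], whence the factor [va]. *)
move=> v_ok; rewrite -mulrA -(@two_cups_cross_cap ((Cup, 0%N) :: v)) //=.
rewrite -addrA -mulrN -mulrDr addrC [- _ + _]addrC -opprB mulrN.
rewrite -(@word_value_skein [:: (Cup, 0%N); (Cup, 2%N); (crX, 1%N)] v 0);
  by rewrite ?opprB ?subrK // /admissible /= ?v_ok.
Qed.

(** The rotation consumes one crossing of the second section, hence [d.+1]. The values [c = 0] and
    [d = 0] are kept for the degenerate relations. *)
Lemma reduce_first_section c d v : closes 4 v ->
  ev [:: (Cup, 0%N), (Cup, 2%N) &
      nseq c.+2 (crX, 1%N) ++ nseq d.+1 (crXbar, 0%N) ++ v] =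
    ev [:: (Cup, 0%N), (Cup, 2%N) &
        nseq c (crX, 1%N) ++ nseq d.+1 (crXbar, 0%N) ++ v]
    - vz * va^-1 ^+ c.+1 *
      ev [:: (Cup, 0%N), (Cup, 2%N), (crX, 1%N) & nseq d (crXbar, 0%N) ++ v]
    + vz * ev [:: (Cup, 0%N), (Cup, 2%N) &
        nseq c.+1 (crX, 1%N) ++ nseq d.+1 (crXbar, 0%N) ++ v].
Proof.
move=> v_ok; set w := nseq d.+1 _ ++ v.
have w_ok : closes 4 w by rewrite closes_nseq_cross.
have cw_ok k : closes 4 (nseq k (crX, 1%N) ++ w) by rewrite closes_nseq_cross.
rewrite -mulrA -nested_cups_rotate ?closes_nseq_cross //.
rewrite -(@cup_curls 1 true c.+1 w) //.
apply: etrans (resolve_first_section (cw_ok c.+1)) _.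
congr (_ - _ + _).
by apply: (@cancel_crossings [:: (Cup, 0%N); (Cup, 2%N)] _ false 1);
  rewrite /admissible /= cw_ok.
Qed.

Lemma reduce_second_section d v : closes 4 v ->
  ev [:: (Cup, 0%N), (Cup, 2%N), (crX, 1%N) & nseq d.+2 (crXbar, 0%N) ++ v] =
    ev [:: (Cup, 0%N), (Cup, 2%N), (crX, 1%N) & nseq d (crXbar, 0%N) ++ v]
    - vz *
      ev [:: (Cup, 0%N), (Cup, 2%N), (crX, 1%N) & nseq d.+1 (crXbar, 0%N) ++ v]
    + vz * va ^+ d.+2 * ev [:: (Cup, 0%N), (Cup, 2%N) & v].
Proof.
move=> v_ok.
have dv_ok k : closes 4 (nseq k (crXbar, 0%N) ++ v).
  by rewrite closes_nseq_cross.
(* One factor [va] comes from the capped [crX], the other [d.+1] from the rest of the row, now curls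
   on the new upper arc. *)
rewrite [va ^+ d.+2]exprS mulrA -(mulrA (vz * va)) -(@two_cups v) //.
rewrite -(@cup_curls 0 false d.+1 v) //.
apply: etrans (resolve_second_section (dv_ok d.+1)) _.
congr (_ - _ + _).
by apply: (@cancel_crossings [:: (Cup, 0%N); (Cup, 2%N); (crX, 1%N)] _ true 0);
  rewrite /admissible /= dv_ok.
Qed.

Lemma reduce_single_crossings c d v : closes 4 v ->
  ev [:: (Cup, 0%N), (Cup, 2%N), (crX, 1%N), (crXbar, 0%N) &
      nseq c (crX, 1%N) ++ nseq d.+1 (crXbar, 0%N) ++ v] =
    va ^- c *
      ev [:: (Cup, 0%N), (Cup, 2%N), (crX, 1%N) & nseq d (crXbar, 0%N) ++ v]
    - vz * ev [:: (Cup, 0%N), (Cup, 2%N) &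
        nseq c.+1 (crX, 1%N) ++ nseq d.+1 (crXbar, 0%N) ++ v]
    + vz * va * ev [:: (Cup, 0%N), (Cup, 2%N) &
        nseq c (crX, 1%N) ++ nseq d.+1 (crXbar, 0%N) ++ v].
Proof.
move=> v_ok.
have dv_ok k : closes 4 (nseq k (crXbar, 0%N) ++ v).
  by rewrite closes_nseq_cross.
rewrite resolve_second_section; last by rewrite !closes_nseq_cross.
rewrite cup_slide // two_cups; last by rewrite !closes_nseq_cross.
(* With the [c] crossings gone as curls, the switched crossing meets the next row and cancels its
   first [crXbar]. *)
congr (_ * _ - _ + _).
by apply: (@cancel_crossings [:: (Cup, 0%N); (Cup, 2%N); (crX, 1%N)] _ true 0);
  rewrite /admissible /= dv_ok.
Qed.

End LeftEnd.

(** * The eight relations *)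

Lemma standard_value (P : diagram -> ratfun) b :
  P (D b) = word_value P (standard_word b).
Proof. by rewrite (word_valueE P (standard_wordP b)). Qed.

Theorem theorem1 (P : diagram -> ratfun) (P_dubrovnik : dubrovnik P)
    (n : nat) (b : seq nat) (n_odd : odd n) (size_b : size b = n)
    (b_pos : all (fun c => 0 < c)%N b) :
  (forall (b1 b2 b3 : nat) (bs : seq nat),
    b = [:: b1, b2, b3 & bs] -> (3 <= b1)%N -> (2 <= b2)%N ->
    P (D [:: b1, b2, b3 & bs]) =
      P (D [:: (b1 - 2)%N, b2, b3 & bs])
      - vz * va ^ (1 - b1%:Z) * P (D [:: 1%N, (b2 - 1)%N, b3 & bs])
      + vz * P (D [:: (b1 - 1)%N, b2, b3 & bs]))
  /\
  (forall (b2 b3 : nat) (bs : seq nat),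
    b = [:: 2%N, b2, b3 & bs] -> (2 <= b2)%N ->
    P (D [:: 2%N, b2, b3 & bs]) =
      va ^+ b2 * P (D (b3 :: bs))
      - vz * va^-1 * P (D [:: 1%N, (b2 - 1)%N, b3 & bs])
      + vz * P (D [:: 1%N, b2, b3 & bs]))
  /\
  (forall (b2 b3 : nat) (bs : seq nat),
    b = [:: 1%N, b2, b3 & bs] -> (3 <= b2)%N ->
    P (D [:: 1%N, b2, b3 & bs]) =
      P (D [:: 1%N, (b2 - 2)%N, b3 & bs])
      - vz * P (D [:: 1%N, (b2 - 1)%N, b3 & bs])
      + vz * va ^+ b2 * P (D (b3 :: bs)))
  /\
  (forall (b1 b3 : nat) (bs : seq nat),
    b = [:: b1, 1%N, b3 & bs] -> (3 <= b1)%N ->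
    P (D [:: b1, 1%N, b3 & bs]) =
      P (D [:: (b1 - 2)%N, 1%N, b3 & bs])
      - vz * va ^ (1 - b1%:Z) * P (D ((b3 + 1)%N :: bs))
      + vz * P (D [:: (b1 - 1)%N, 1%N, b3 & bs]))
  /\
  (forall (b3 : nat) (bs : seq nat),
    b = [:: 2%N, 1%N, b3 & bs] ->
    P (D [:: 2%N, 1%N, b3 & bs]) =
      va * P (D (b3 :: bs))
      - vz * va^-1 * P (D ((b3 + 1)%N :: bs))
      + vz * P (D [:: 1%N, 1%N, b3 & bs]))
  /\
  (forall (b3 : nat) (bs : seq nat),
    b = [:: 1%N, 2%N, b3 & bs] ->
    P (D [:: 1%N, 2%N, b3 & bs]) =
      P (D ((b3 + 1)%N :: bs))
      - vz * P (D [:: 1%N, 1%N, b3 & bs])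
      + vz * va ^+ 2 * P (D (b3 :: bs)))
  /\
  (forall (b3 b4 b5 : nat) (bs : seq nat),
    b = [:: 1%N, 1%N, b3, b4, b5 & bs] -> (2 <= b4)%N ->
    P (D [:: 1%N, 1%N, b3, b4, b5 & bs]) =
      va ^- b3 * P (D [:: 1%N, (b4 - 1)%N, b5 & bs])
      - vz * P (D [:: (b3 + 1)%N, b4, b5 & bs])
      + vz * va * P (D [:: b3, b4, b5 & bs]))
  /\
  (forall (b3 b5 : nat) (bs : seq nat),
    b = [:: 1%N, 1%N, b3, 1%N, b5 & bs] ->
    P (D [:: 1%N, 1%N, b3, 1%N, b5 & bs]) =
      va ^- b3 * P (D ((1 + b5)%N :: bs))
      - vz * P (D [:: (b3 + 1)%N, 1%N, b5 & bs])
      + vz * va * P (D [:: b3, 1%N, b5 & bs])).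
Proof.
(* Splitting off two sections preserves the parity of the length, hence the right closure. *)
set tail := fun o b => twists o b ++ right_closure (size b).
have tail_ok o b' : closes 4 (tail o b').
  by rewrite /tail closes_twists /right_closure; case: odd.
have twoE b1 b2 bs :
    P (D [:: b1, b2 & bs]) = word_value P [:: (Cup, 0%N), (Cup, 2%N) &
      nseq b1 (crX, 1%N) ++ nseq b2 (crXbar, 0%N) ++ tail true bs].
  by rewrite standard_value /standard_word /= right_closureSS -!catA.
have oneE b1 bs :
    P (D (b1 :: bs)) = word_value P [:: (Cup, 0%N), (Cup, 2%N) &
      nseq b1 (crX, 1%N) ++ twists false bs ++ right_closure (size bs).+1].
  by rewrite standard_value /standard_word /= -!catA.
have anyE bs :
    P (D bs) = word_value P [:: (Cup, 0%N), (Cup, 2%N) & tail true bs].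
  by rewrite standard_value.
(* [D] accepts empty sections: an empty second one fuses its neighbours. *)
have merge c bs : P (D [:: 1%N, 0%N, c & bs]) = P (D ((1 + c)%N :: bs)).
  by rewrite twoE oneE /tail add1n /= -catA.
(* After an empty first section, the second is a row of positive curls on the upper arc. *)
have drop0 c bs : P (D [:: 0%N, c & bs]) = va ^+ c * P (D bs).
  by rewrite twoE anyE cup_curls0.
have first c d bs : P (D [:: c.+2, d.+1 & bs]) =
    P (D [:: c, d.+1 & bs]) - vz * va ^ (1 - c.+2%:Z) * P (D [:: 1%N, d & bs])
    + vz * P (D [:: c.+1, d.+1 & bs]).
  have -> : 1 - c.+2%:Z = - c.+1%:Z :> int.
    by rewrite [c.+2%:Z]intS opprD addrA subrr add0r.
  by rewrite -exprz_inv !twoE reduce_first_section.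
have second d bs : P (D [:: 1%N, d.+2 & bs]) =
    P (D [:: 1%N, d & bs]) - vz * P (D [:: 1%N, d.+1 & bs])
    + vz * va ^+ d.+2 * P (D bs).
  by rewrite !twoE anyE reduce_second_section.
have single c d bs : P (D [:: 1%N, 1%N, c, d.+1 & bs]) =
    va ^- c * P (D [:: 1%N, d & bs]) - vz * P (D [:: c.+1, d.+1 & bs])
    + vz * va * P (D [:: c, d.+1 & bs]).
  rewrite !twoE -reduce_single_crossings // /tail /= right_closureSS.
  by rewrite -!catA cat_cons -!catA.
split=> [b1 b2 b3 bs _|].
  by case: b1 b2 => [|[|c]] [|d] // _ _; rewrite first !subSS !subn0.
split=> [b2 b3 bs _|].
  by case: b2 => // d _; rewrite first drop0 subSS subn0.
split=> [b2 b3 bs _|].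
  by case: b2 => [|[|d]] // _; rewrite second !subSS !subn0.
split=> [b1 b3 bs _|].
  by case: b1 => [|[|c]] // _; rewrite first merge addnC !subSS !subn0.
(* Both degenerations occur: [c = 0] calls for [drop0] and [d = 0] for [merge]. *)
split=> [b3 bs _|]; first by rewrite first drop0 merge expr1 addnC.
split=> [b3 bs _|]; first by rewrite second merge addnC.
split=> [b3 b4 b5 bs _|b3 b5 bs _]; last by rewrite single merge addn1.
by case: b4 => // d _; rewrite single addn1 subSS subn0.
Qed.
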